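(* Let $p\ge5$ be a prime with Legendre symbol $\left(\frac{-1}{p}\right)=-1$, and let $\alpha\ge0$, $n\ge0$ be integers. Then for every integer $i$ with $1\le i\le p-1$, $$\overline{S}_3\big(48p^{2\alpha+2}n+6(8i+p)p^{2\alpha+1}\big)\equiv0\pmod{12}.$$
   Context: For $|q|<1$ and a positive integer $k$, write $f_k=\prod_{j\ge1}(1-q^{kj})$. The function $\overline{S}_3(n)$ (number of $3$-Schur overpartitions of $n$) is defined by $\sum_{n\ge0}\overline{S}_3(n)q^n=\prod_{n\ge1}\frac{(1+q^{2n-1})(1-q^{3(2n-1)})}{(1+q^{3(2n-1)})(1-q^{2n-1})}=\frac{f_2^3f_3^2f_{12}}{f_1^2f_4f_6^3}$. *)

(* Defs.v *)
From mathcomp Require Import all_boot all_order all_algebra.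

Set Implicit Arguments.
Unset Strict Implicit.
Unset Printing Implicit Defensive.

Import GRing.Theory.
Local Open Scope ring_scope.

(* Formal power series over int, as coefficient sequences. *)
Definition fps := nat -> int.

Definition fps_one : fps := fun n => (n == 0%N)%:R.

(* The monomial q^m. *)
Definition fps_q (m : nat) : fps := fun n => (n == m)%:R.

Definition fps_add (a b : fps) : fps := fun n => a n + b n.

Definition fps_sub (a b : fps) : fps := fun n => a n - b n.

Definition fps_mul (a b : fps) : fps :=
  fun n => \sum_(i < n.+1) a i * b (n - i)%N.

Definition fps_exp (a : fps) (k : nat) : fps := iter k (fps_mul a) fps_one.

(* The inverse of a series with constant term 1, as the geometric series
   \sum_k (1 - a)^k; since 1 - a has no constant term, only the terms with
   k <= n contribute to the coefficient of q^n.  See fps_mulV. *)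
Definition fps_inv (a : fps) : fps :=
  fun n => \sum_(k < n.+1) fps_exp (fps_sub fps_one a) k n.

Definition fps_div (a b : fps) : fps := fps_mul a (fps_inv b).

(* The finite product \prod_(1 <= j <= N) F j. *)
Fixpoint fps_partial_prod (F : nat -> fps) (N : nat) : fps :=
  if N is N'.+1 then fps_mul (fps_partial_prod F N') (F N) else fps_one.

(* The infinite product \prod_(j >= 1) F j, for factors F j congruent to 1
   modulo q^j: the factors with j > n do not affect the coefficient of q^n.
   See fps_prod_limit. *)
Definition fps_prod (F : nat -> fps) : fps := fun n => fps_partial_prod F n n.

Definition schur3_factor (n : nat) : fps :=
  let r := (2 * n - 1)%N in
  fps_div
    (fps_mul (fps_add fps_one (fps_q r)) (fps_sub fps_one (fps_q (3 * r)%N)))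
    (fps_mul (fps_add fps_one (fps_q (3 * r)%N)) (fps_sub fps_one (fps_q r))).

(* The number of 3-Schur overpartitions of n. *)
Definition S3bar : nat -> int := fps_prod schur3_factor.

Definition legendre (a : int) (p : nat) : int :=
  if (p %| a)%Z then 0
  else if [exists x : 'I_p, ((x : nat)%:Z ^+ 2 == a %[mod p])%Z] then 1
  else -1.

(* a = 1 + O(q^m) *)
Definition fps_unip (m : nat) (a : fps) : Prop :=
  forall i, (i < m)%N -> a i = fps_one i.

(* a = O(q^m) *)
Definition fps_small (m : nat) (a : fps) : Prop :=
  forall i, (i < m)%N -> a i = 0.

Lemma fps_mul_unipr m (a b : fps) n :
  fps_unip m b -> (n < m)%N -> fps_mul a b n = a n.
Proof.
move=> ub lt_nm; rewrite /fps_mul big_ord_recr /= subnn ub ?(leq_ltn_trans _ lt_nm) //.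
rewrite /fps_one eqxx mulr1 big1 ?add0r // => i _.
rewrite ub ?(leq_ltn_trans (leq_subr _ _)) // /fps_one subn_eq0 leqNgt ltn_ord.
by rewrite mulr0.
Qed.

Lemma fps_mul_unip m (a b : fps) :
  fps_unip m a -> fps_unip m b -> fps_unip m (fps_mul a b).
Proof. by move=> ua ub i lt_im; rewrite (fps_mul_unipr _ ub) // ua. Qed.

Lemma fps_mul_small m k (a b : fps) :
  fps_small m a -> fps_small k b -> fps_small (m + k) (fps_mul a b).
Proof.
move=> sa sb i lt_i; rewrite /fps_mul big1 // => j _.
have [lt_jm | le_mj] := ltnP j m; first by rewrite sa // mul0r.
rewrite sb ?mulr0 //.
have [lt_ij | le_ji] := ltnP i j.
  by move: (ltn_ord j); rewrite ltnS leqNgt lt_ij.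
by rewrite ltn_subLR // (leq_trans lt_i) // leq_add2r.
Qed.

Lemma fps_exp_small m (a : fps) k :
  fps_small m a -> fps_small (m * k) (fps_exp a k).
Proof.
move=> sa; elim: k => [|k IHk]; first by rewrite muln0.
by rewrite mulnS; apply: fps_mul_small.
Qed.

Lemma fps_sub1_small m (a : fps) :
  fps_unip m a -> fps_small m (fps_sub fps_one a).
Proof. by move=> ua i lt_im; rewrite /fps_sub ua // subrr. Qed.

Lemma fps_inv_unip m (a : fps) : fps_unip m a -> fps_unip m (fps_inv a).
Proof.
move=> /fps_sub1_small sa i lt_im.
rewrite /fps_inv big_ord_recl big1 ?addr0 // => k _.
apply: (@fps_exp_small m _ (lift ord0 k) sa).
by rewrite (leq_trans lt_im) // leq_pmulr.
Qed.

Lemma fps_mulV (a : fps) n : a 0%N = 1 -> fps_mul a (fps_inv a) n = fps_one n.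
Proof.
move=> a0; set b := fps_sub fps_one a.
have sb : fps_small 1 b.
  by apply: fps_sub1_small => -[|i] //; rewrite a0.
have exp0 k i : (i < k)%N -> fps_exp b k i = 0.
  by move=> lt_ik; apply: (fps_exp_small sb); rewrite mul1n.
have step k : fps_mul a (fps_exp b k) n = fps_exp b k n - fps_exp b k.+1 n.
  have e1 : fps_exp b k n = \sum_(i < n.+1) fps_one i * fps_exp b k (n - i)%N.
    rewrite big_ord_recl /= mul1r subn0 big1 ?addr0 // => i _.
    by rewrite /fps_one /= mul0r.
  rewrite [X in X - _]e1 [fps_exp b k.+1 n]/(fps_mul b (fps_exp b k) n).
  rewrite /fps_mul -sumrB; apply: eq_bigr => i _.
  by rewrite -mulrBl /b /fps_sub opprB addrCA subrr addr0.
have inv_wide i : (i <= n)%N ->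
    fps_inv a i = \sum_(k < n.+1) fps_exp b k i.
  move=> le_in; rewrite /fps_inv -/b.
  rewrite (big_ord_widen n.+1 (fun k => fps_exp b k i)) // [RHS](bigID (fun k : 'I__ => k < i.+1)%N) /=.
  rewrite [X in _ = _ + X]big1 ?addr0 // => k; rewrite -leqNgt.
  exact: exp0.
transitivity (\sum_(k < n.+1) fps_mul a (fps_exp b k) n).
  rewrite /fps_mul exchange_big /=; apply: eq_bigr => i _.
  by rewrite inv_wide ?leq_subr // mulr_sumr.
under eq_bigr do rewrite step.
rewrite -(big_mkord xpredT (fun k => fps_exp b k n - fps_exp b k.+1 n)).
under eq_bigr do rewrite -opprB.
by rewrite sumrN telescope_sumr // opprB (exp0 n.+1) ?subr0.
Qed.

Lemma fps_prod_limit F n N :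
    (forall j, (0 < j)%N -> fps_unip j (F j)) -> (n <= N)%N ->
  fps_partial_prod F N n = fps_prod F n.
Proof.
move=> uF /subnKC <-; elim: (N - n)%N => [|d IHd]; first by rewrite addn0.
rewrite addnS /= (fps_mul_unipr (m := (n + d).+1)) ?IHd ?ltnS ?leq_addr //.
exact: uF.
Qed.

Lemma schur3_factor_unip j : (0 < j)%N -> fps_unip j (schur3_factor j).
Proof.
move=> j_gt0.
have uD r : (j <= r)%N -> fps_unip j (fps_add fps_one (fps_q r)).
  by move=> le_jr i lt_ij; rewrite /fps_add /fps_q ltn_eqF ?addr0 ?(leq_trans lt_ij).
have uB r : (j <= r)%N -> fps_unip j (fps_sub fps_one (fps_q r)).
  by move=> le_jr i lt_ij; rewrite /fps_sub /fps_q ltn_eqF ?subr0 ?(leq_trans lt_ij).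
have le_jr : (j <= 2 * j - 1)%N by rewrite mul2n -addnn -addnBA // leq_addr.
have le_j3r : (j <= 3 * (2 * j - 1))%N by rewrite (leq_trans le_jr) // leq_pmull.
rewrite /schur3_factor /fps_div.
apply: fps_mul_unip; last apply: fps_inv_unip; apply: fps_mul_unip; auto.
Qed.

(* The partial products of the generating function converge q-adically to
   S3bar. *)
Lemma S3bar_limit n N : (n <= N)%N ->
  fps_partial_prod schur3_factor N n = S3bar n.
Proof. exact/fps_prod_limit/schur3_factor_unip. Qed.

(* Main.v *)
(* The index is 6 M with M odd and the p-adic valuation of M odd; these are the
   only properties of it that matter.

   Modulo 4, each factor (1 + x) / (1 - x) * (1 - x^3) / (1 + x^3) is
   1 + 2 (sum_(k >= 1) x^k + sum_(k >= 1) x^(3 k)), so the coefficient of q^(6 M)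
   is twice the number of divisors of 3 M plus twice that of M, and both numbers
   are even because d |-> K / d exchanges even and odd p-adic valuations.

   Modulo 3, the Frobenius turns the generating function into
   phi(-q) / phi(q), where phi = sum_(n : Z) q^(n^2).  From
   phi(q) phi(-q) = phi(-q^2)^2 and phi(q) = phi(q^4) + 2 q psi(q^8) one gets
   sum_n S(4 n + 2) q^n = 8 Z(q^2)^2 / phi(-q)^6 with Z = phi(-q)^2 psi(q) and
   Z(q)^2 = phi(-q)^3 Z(q^2).  Differentiating the latter in characteristic 3
   shows that Z' = Z'(q^2) phi(-q)^3 / Z for ' = q d/dq, whence Z' = 0 by
   comparing orders.  Thus sum_n S(4 n + 2) q^n is a series in q^3, and
   6 M = 4 n + 2 with n = 1 modulo 3. *)

Require Import Defs.
From HB Require Import structures.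
From mathcomp Require Import all_boot all_order all_algebra.
From mathcomp Require Import boolp ring zify.

Set Implicit Arguments.
Unset Strict Implicit.
Unset Printing Implicit Defensive.

Import GRing.Theory.
Local Open Scope ring_scope.

(** * Formal power series *)

(** [fps] is convertible to [series int], and the operations below copy those on [fps], so ring
    lemmas apply to the given definitions. *)
Definition series (R : Type) := nat -> R.

HB.instance Definition _ (R : Type) := gen_eqMixin (series R).
HB.instance Definition _ (R : Type) := gen_choiceMixin (series R).

Section SeriesRing.
Variable R : comNzRingType.
Implicit Types a b c : series R.

Definition series_zero : series R := fun _ => 0.
Definition series_opp a : series R := fun n => - a n.
Definition series_add a b : series R := fun n => a n + b n.
Definition series_one : series R := fun n => (n == 0%N)%:R.
Definition series_mul a b : series R :=
  fun n => \sum_(i < n.+1) a i * b (n - i)%N.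

Fact series_addA : associative series_add.
Proof. by move=> a b c; apply/funext => n; rewrite /series_add addrA. Qed.
Fact series_addC : commutative series_add.
Proof. by move=> a b; apply/funext => n; rewrite /series_add addrC. Qed.
Fact series_add0 : left_id series_zero series_add.
Proof. by move=> a; apply/funext => n; rewrite /series_add add0r. Qed.
Fact series_addN : left_inverse series_zero series_opp series_add.
Proof. by move=> a; apply/funext => n; rewrite /series_add addNr. Qed.

HB.instance Definition _ :=
  GRing.isZmodule.Build (series R) series_addA series_addC series_add0 series_addN.

Definition series_trunc N a : {poly R} := \poly_(i < N) a i.

(** Each coefficient of a product depends on finitely many coefficients, so the ring laws can be
    inherited from polynomials. *)
Lemma series_mul_trunc N a b n : (n < N)%N ->
  series_mul a b n = (series_trunc N a * series_trunc N b)`_n.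
Proof.
move=> lt_nN; rewrite coefM; apply: eq_bigr => i _.
by rewrite !coef_poly (leq_ltn_trans (leq_subr _ _) lt_nN)
           (leq_ltn_trans _ lt_nN) // -ltnS.
Qed.

Fact series_mulC : commutative series_mul.
Proof.
by move=> a b; apply/funext => n; rewrite !(@series_mul_trunc n.+1) // mulrC.
Qed.

Fact series_mulA : associative series_mul.
Proof.
move=> a b c; apply/funext => n.
have mulE u v i : (i < n.+1)%N ->
    series_mul u v i = (series_trunc n.+1 u * series_trunc n.+1 v)`_i.
  exact: series_mul_trunc.
have truncM u v i : (i < n.+1)%N -> (series_trunc n.+1 (series_mul u v))`_i
    = (series_trunc n.+1 u * series_trunc n.+1 v)`_i.
  by move=> lt_in; rewrite coef_poly lt_in mulE.
rewrite !mulE // coefM.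
transitivity ((series_trunc n.+1 a * (series_trunc n.+1 b * series_trunc n.+1 c))`_n).
  by rewrite coefM; apply: eq_bigr => i _; rewrite truncM // ltnS leq_subr.
by rewrite mulrA !coefM; apply: eq_bigr => i _; rewrite truncM.
Qed.

Fact series_mul1 : left_id series_one series_mul.
Proof.
move=> a; apply/funext => n; rewrite /series_mul big_ord_recl /= mul1r subn0.
by rewrite big1 ?addr0 // => i _; rewrite /series_one /= mul0r.
Qed.

Fact series_mulDl : left_distributive series_mul series_add.
Proof.
move=> a b c; apply/funext => n; rewrite /series_mul /series_add -big_split /=.
by apply: eq_bigr => i _; rewrite mulrDl.
Qed.

Fact series_one_neq0 : series_one != series_zero.
Proof.
apply/eqP => /(congr1 (fun a : series R => a 0%N)) /eqP.
by rewrite /series_one /series_zero /= oner_eq0.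
Qed.

HB.instance Definition _ := GRing.Zmodule_isComNzRing.Build (series R)
  series_mulA series_mulC series_mul1 series_mulDl series_one_neq0.

Lemma coefsD a b n : (a + b) n = a n + b n. Proof. by []. Qed.
Lemma coefsN a n : (- a) n = - a n. Proof. by []. Qed.
Lemma coefsB a b n : (a - b) n = a n - b n. Proof. by []. Qed.
Lemma coefs1 n : (1 : series R) n = (n == 0%N)%:R. Proof. by []. Qed.
Lemma coefsM a b n : (a * b) n = \sum_(i < n.+1) a i * b (n - i)%N.
Proof. by []. Qed.
Lemma coefsM0 a b : (a * b) 0%N = a 0%N * b 0%N.
Proof. by rewrite coefsM big_ord1. Qed.

Lemma coefs_sum I (r : seq I) (P : pred I) (F : I -> series R) n :
  (\sum_(i <- r | P i) F i) n = \sum_(i <- r | P i) F i n.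
Proof. by apply: (big_morph (fun a : series R => a n)). Qed.

Lemma coefsX0 a k : (a ^+ k) 0%N = a 0%N ^+ k.
Proof. by elim: k => [|k IHk] //; rewrite !exprS coefsM0 IHk. Qed.

Lemma coefs_prod0 I (r : seq I) (F : I -> series R) :
  (\prod_(i <- r) F i) 0%N = \prod_(i <- r) F i 0%N.
Proof. by apply: (big_morph (fun a : series R => a 0%N) coefsM0). Qed.

Lemma coefsMn a k n : (a *+ k) n = a n *+ k.
Proof. by elim: k => [|k IHk] //; rewrite !mulrS coefsD IHk. Qed.

(** The indeterminate q. *)
Definition sq : series R := fun n => (n == 1%N)%:R.

Lemma coefs_sqM a n : (sq * a) n = if n is n'.+1 then a n' else 0.
Proof.
rewrite coefsM; case: n => [|n]; first by rewrite big_ord1 mul0r.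
rewrite !big_ord_recl /= [sq 0%N]/(0 : R) mul0r add0r [sq 1%N]/(1 : R) mul1r.
by rewrite subn1 big1 ?addr0 // => i _; rewrite [sq _]/(0 : R) mul0r.
Qed.

Lemma coefs_sqXM a k n : (sq ^+ k * a) n = if (k <= n)%N then a (n - k)%N else 0.
Proof.
elim: k n => [|k IHk] n; first by rewrite mul1r subn0.
by rewrite exprS -mulrA coefs_sqM; case: n => [|n] //; rewrite IHk ltnS subSS.
Qed.

Lemma coefs_sqX k n : (sq ^+ k) n = (n == k)%:R.
Proof.
rewrite -[sq ^+ k]mulr1 coefs_sqXM coefs1 subn_eq0.
by case: (ltngtP k n).
Qed.

Lemma sq_lreg a b : sq * a = sq * b -> a = b.
Proof.
move=> eq_ab; apply/funext => n.
by have := congr1 (fun c : series R => c n.+1) eq_ab; rewrite !coefs_sqM.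
Qed.

(** * Congruences modulo powers of q, and limits *)

Definition series_eqmod T a b := forall i, (i < T)%N -> a i = b i.

(** Lets identities behind infinite products be checked modulo each q^(T+1), with finite products
    only. *)
Lemma series_eqmod_all a b : (forall T, series_eqmod T.+1 a b) -> a = b.
Proof. by move=> eq_ab; apply/funext => n; apply: (eq_ab n). Qed.

Lemma series_eqmod_sym T a b : series_eqmod T a b -> series_eqmod T b a.
Proof. by move=> eq_ab i lt_iT; rewrite eq_ab. Qed.

Lemma series_eqmod_trans T a b c :
  series_eqmod T a b -> series_eqmod T b c -> series_eqmod T a c.
Proof. by move=> eq_ab eq_bc i lt_iT; rewrite eq_ab ?eq_bc. Qed.

Lemma series_eqmod_leq T1 T2 a b :
  (T1 <= T2)%N -> series_eqmod T2 a b -> series_eqmod T1 a b.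
Proof. by move=> le_T eq_ab i /leq_trans/(_ le_T)/eq_ab. Qed.

Lemma series_eqmodD T a b c d :
  series_eqmod T a b -> series_eqmod T c d -> series_eqmod T (a + c) (b + d).
Proof. by move=> eq_ab eq_cd i lt_iT; rewrite !coefsD eq_ab ?eq_cd. Qed.

Lemma series_eqmodM T a b c d :
  series_eqmod T a b -> series_eqmod T c d -> series_eqmod T (a * c) (b * d).
Proof.
move=> eq_ab eq_cd i lt_iT; rewrite !coefsM; apply: eq_bigr => j _.
by rewrite eq_ab ?eq_cd ?(leq_ltn_trans _ lt_iT) ?leq_subr // -ltnS.
Qed.

Lemma series_eqmodMl T a c d :
  series_eqmod T c d -> series_eqmod T (a * c) (a * d).
Proof. exact: series_eqmodM. Qed.

Lemma series_eqmodMr T a c d :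
  series_eqmod T c d -> series_eqmod T (c * a) (d * a).
Proof. by move/series_eqmodM; apply. Qed.

Lemma series_eqmod_sqXM T k a : (T <= k)%N -> series_eqmod T (sq ^+ k * a) 0.
Proof.
by move=> le_Tk i lt_iT; rewrite coefs_sqXM leqNgt (leq_trans lt_iT).
Qed.

Lemma series_eqmod_cancel T a b c :
  a 0%N = 1 -> series_eqmod T (b * a) (c * a) -> series_eqmod T b c.
Proof.
move=> a0 eq_ba; elim/ltn_ind => i IHi lt_iT; have := eq_ba i lt_iT.
rewrite !coefsM !big_ord_recr /= subnn a0 !mulr1.
under eq_bigr => j _ do rewrite IHi ?(ltn_trans _ lt_iT) //.
exact: addrI.
Qed.

Lemma series_cancel a b c : a 0%N = 1 -> b * a = c * a -> b = c.
Proof.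
by move=> a0 eq_ba; apply: series_eqmod_all => T;
  apply: (series_eqmod_cancel a0); rewrite eq_ba.
Qed.

Definition series_lim (u : nat -> series R) : series R := fun n => u n n.

Lemma series_lim_eqmod (u : nat -> series R) m :
    (forall n, series_eqmod n.+1 (u n.+1) (u n)) ->
  series_eqmod m.+1 (series_lim u) (u m).
Proof.
move=> u_cauchy i; rewrite ltnS => /subnKC <-; rewrite /series_lim.
elim: (m - i)%N => [|d IHd]; first by rewrite addn0.
by rewrite addnS u_cauchy // ltnS leq_addr.
Qed.

End SeriesRing.

Arguments sq {R}.

(** * Ring endomorphisms and a derivation of the series ring *)

Section SeriesMorphisms.
Variable R : comNzRingType.
Implicit Types a b c : series R.

(* The substitutions q -> -q and q -> q^2, and the derivation q d/dq. *)
Definition sneg a : series R := fun n => (-1) ^+ n * a n.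
Definition sdil a : series R := fun n => if odd n then 0 else a n./2.
Definition sder a : series R := fun n => a n *+ n.

Fact sneg_is_zmod_morphism : zmod_morphism sneg.
Proof. by move=> a b; apply/funext => n; rewrite /sneg !coefsB /= mulrBr. Qed.

Fact sneg_is_monoid_morphism : monoid_morphism sneg.
Proof.
split=> [|a b]; apply/funext => n.
  by rewrite /sneg coefs1; case: n => [|n]; rewrite ?mulr1 //= mulr0.
rewrite /sneg !coefsM mulr_sumr; apply: eq_bigr => i _.
by rewrite mulrACA -exprD subnKC // -ltnS.
Qed.

HB.instance Definition _ :=
  GRing.isZmodMorphism.Build (series R) (series R) sneg sneg_is_zmod_morphism.
HB.instance Definition _ :=
  GRing.isMonoidMorphism.Build (series R) (series R) sneg sneg_is_monoid_morphism.

Fact sdil_is_zmod_morphism : zmod_morphism sdil.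
Proof.
by move=> a b; apply/funext => n; rewrite coefsB /sdil; case: ifP; rewrite ?subr0.
Qed.

Lemma sdil_even a n : sdil a n.*2 = a n.
Proof. by rewrite /sdil odd_double doubleK. Qed.

Lemma sdil_odd a n : sdil a n.*2.+1 = 0.
Proof. by rewrite /sdil /= odd_double. Qed.

Fact sdil_is_monoid_morphism : monoid_morphism sdil.
Proof.
split=> [|a b]; apply/funext => n; rewrite -[n]odd_double_half.
  by case: (odd n); rewrite ?add1n ?sdil_odd // add0n sdil_even !coefs1 double_eq0.
case: (odd n); rewrite ?add1n ?sdil_odd ?add0n ?sdil_even !coefsM.
  rewrite big1 // => i _; rewrite /sdil; case: ifP; rewrite ?mul0r // => odd_i.
  by rewrite oddB /= ?odd_double ?odd_i ?mulr0 // -ltnS.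
set m := n./2; rewrite -(big_mkord xpredT (fun i => a i * b (m - i)%N)).
rewrite -(big_mkord xpredT (fun i => sdil a i * sdil b (m.*2 - i)%N)).
(* With m fixed, passing from k to k + 1 adds the index 2k + 1, which contributes 0, and the index
   2k + 2. *)
have step k : (k <= m)%N ->
    \sum_(0 <= i < k.*2.+1) sdil a i * sdil b (m.*2 - i)%N =
    \sum_(0 <= i < k.+1) a i * b (m - i)%N.
  elim: k => [|k IHk] lt_km.
    by rewrite !big_nat1 !subn0 sdil_even (sdil_even a 0).
  rewrite doubleS big_nat_recr // big_nat_recr //= IHk 1?ltnW //.
  by rewrite sdil_odd mul0r addr0 [RHS]big_nat_recr //= -doubleS -doubleB !sdil_even.
by rewrite step.
Qed.

HB.instance Definition _ :=
  GRing.isZmodMorphism.Build (series R) (series R) sdil sdil_is_zmod_morphism.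
HB.instance Definition _ :=
  GRing.isMonoidMorphism.Build (series R) (series R) sdil sdil_is_monoid_morphism.

Lemma sneg_sq : sneg sq = - sq.
Proof.
by apply/funext => -[|[|n]]; rewrite coefsN /sneg /sq /= ?mulr0 ?oppr0 ?mulr1.
Qed.

Lemma sdil_sq : sdil sq = sq ^+ 2.
Proof.
apply/funext => n; rewrite coefs_sqX -[n]odd_double_half.
case: (odd n); rewrite ?add1n ?sdil_odd ?add0n ?sdil_even /sq; last by case: n./2 => [|[]].
by case: n./2.
Qed.

Lemma sdil_sqX k : sdil (sq ^+ k) = sq ^+ k.*2.
Proof. by rewrite rmorphXn /= sdil_sq -exprM mul2n. Qed.

Lemma sdil_inj : injective sdil.
Proof.
by move=> a b eq_ab; apply/funext => n; rewrite -(sdil_even a) eq_ab sdil_even.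
Qed.

Lemma sneg_sdil a : sneg (sdil a) = sdil a.
Proof.
apply/funext => n; rewrite /sneg /sdil -signr_odd.
by case: ifP; rewrite ?mulr0 ?mul1r.
Qed.

Lemma snegK : involutive sneg.
Proof. by move=> a; apply/funext => n; rewrite /sneg mulrA -expr2 sqrr_sign mul1r. Qed.

Lemma sderMn a k : sder (a *+ k) = sder a *+ k.
Proof. by apply/funext => n; rewrite coefsMn /sder coefsMn mulrnAC. Qed.

Lemma sderM a b : sder (a * b) = sder a * b + a * sder b.
Proof.
apply/funext => n; rewrite coefsD /sder !coefsM -sumrMnl -big_split /=.
apply: eq_bigr => i _; rewrite mulrnAl mulrnAr -mulrnDr subnKC //.
by rewrite -ltnS.
Qed.

Lemma sder_sdil a : sder (sdil a) = sdil (sder a) *+ 2.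
Proof.
apply/funext => n; rewrite coefsMn /sder -[n]odd_double_half.
case: (odd n); rewrite ?add1n ?sdil_odd ?mul0rn // add0n !sdil_even.
by rewrite -mulrnA muln2.
Qed.

Lemma series_eqmod_sdil T a b :
  series_eqmod T a b -> series_eqmod T.*2 (sdil a) (sdil b).
Proof.
move=> eq_ab i lt_iT; rewrite /sdil; case: ifP => // _.
by rewrite eq_ab // -ltn_double; apply: leq_ltn_trans lt_iT; lia.
Qed.

Lemma series_eqmod_sneg T a b :
  series_eqmod T a b -> series_eqmod T (sneg a) (sneg b).
Proof. by move=> eq_ab i lt_iT; rewrite /sneg eq_ab. Qed.

(** The factor 2 stays on the right because 2 need not be invertible in [R]. *)
Lemma series_even_part a : a + sneg a = sdil (fun n => a n.*2) *+ 2.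
Proof.
apply/funext => n; rewrite coefsMn coefsD /sneg -[n]odd_double_half -signr_odd.
rewrite oddD odd_double addbF.
case: (odd n); rewrite ?add1n ?sdil_odd ?add0n ?sdil_even /=.
  by rewrite expr1 mulN1r subrr mul0rn.
by rewrite expr0 mul1r -mulr2n.
Qed.

Lemma series_odd_part a :
  a - sneg a = (sq * sdil (fun n => a n.*2.+1)) *+ 2.
Proof.
apply/funext => n; rewrite coefsMn coefsB coefs_sqM /sneg -[n]odd_double_half.
rewrite -signr_odd oddD odd_double addbF.
case: (odd n); rewrite ?add1n ?add0n ?sdil_even /=.
  by rewrite expr1 mulN1r opprK -mulr2n.
rewrite expr0 mul1r subrr; case: n./2 => [|k]; first by rewrite mul0rn.
by rewrite doubleS sdil_odd mul0rn.
Qed.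

End SeriesMorphisms.

(** * Telescoping for Gauss's identity *)

Section FiniteProducts.
Variables (R : comNzRingType) (q : R).

(* A finite form of Gauss's identity
   sum_(s : Z) (-1)^s q^(s^2) = prod_j (1 - q^j) / (1 + q^j); the proof is a
   telescoping sum in the style of Shanks. *)
Lemma shanks_theta n :
  (1 + 2 * \sum_(0 <= s < n) (-1) ^+ s.+1 * q ^+ (s.+1 * s.+1))
    * \prod_(0 <= j < n) (1 + q ^+ j.+1)
  = \prod_(0 <= j < n) (1 - q ^+ j.+1)
    + 2 * \sum_(0 <= s < n) (-1) ^+ s.+1 * q ^+ (s.+1 * n.+1)
          * (\prod_(0 <= j < s) (1 + q ^+ j.+1)
             * \prod_(s.+1 <= j < n) (1 - q ^+ j.+1)).
Proof.
elim: n => [|n IHn]; first by rewrite !big_geq //; ring.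
pose M k := \prod_(0 <= j < k) (1 + q ^+ j.+1).
pose N k := \prod_(k <= j < n) (1 - q ^+ j.+1).
pose V s := (-1) ^+ s * q ^+ (s.+1 * n.+1) * (M s * N s).
(* The new factor 1 + q^(n+1) turns the s-th correction term at level n into the one at level n + 1
   plus a telescoping difference. Of the boundary values, [V 0] changes 1 + q^(n+1) into 1 - q^(n+1)
   in the main product, and [V n] cancels part of the new square term, leaving the correction term s
   = n. *)
have stepV s : (s < n)%N ->
    (-1) ^+ s.+1 * q ^+ (s.+1 * n.+1) * (M s * N s.+1) * (1 + q ^+ n.+1)
    = (-1) ^+ s.+1 * q ^+ (s.+1 * n.+2)
        * (M s * \prod_(s.+1 <= j < n.+1) (1 - q ^+ j.+1))
      + (V s.+1 - V s).
  move=> lt_sn; rewrite big_nat_recr //= -/(N s.+1) /V.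
  have ->: M s.+1 = M s * (1 + q ^+ s.+1) by rewrite /M big_nat_recr.
  have ->: N s = (1 - q ^+ s.+1) * N s.+1 by rewrite /N big_ltn.
  rewrite (_ : (s.+1 * n.+2 = s.+1 * n.+1 + s.+1)%N); last by lia.
  rewrite (_ : (s.+2 * n.+1 = s.+1 * n.+1 + n.+1)%N); last by lia.
  rewrite !exprD exprS.
  ring.
move: IHn; rewrite -/(M n) -/(N 0%N) => IHn.
have telV : \sum_(0 <= s < n) (V s.+1 - V s) = V n - V 0%N by rewrite telescope_sumr.
have V0 : V 0%N = q ^+ n.+1 * N 0%N by rewrite /V /M big_geq // mul1n; ring.
have Vn : V n = (-1) ^+ n * q ^+ (n.+1 * n.+1) * M n by rewrite /V /N big_geq // mulr1.
rewrite -/(M n.+1) [M n.+1]big_nat_recr // -/(M n).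
rewrite [\prod_(0 <= j < n.+1) _]big_nat_recr // -/(N 0%N) [in LHS]big_nat_recr //=.
rewrite [in RHS]big_nat_recr //= -/(M n) [\prod_(n.+1 <= j < n.+1) _]big_geq // mulr1.
set S := \sum_(0 <= s < n) _ in IHn *; set T := \sum_(0 <= s < n) _ in IHn.
set U := \sum_(0 <= s < n) _.
have stepT : T * (1 + q ^+ n.+1) = U + (V n - V 0%N).
  rewrite -telV /T mulr_suml /U -big_split /= !big_mkord.
  by apply: eq_bigr => i _; apply: stepV.
rewrite (_ : (n.+1 * n.+2 = n.+1 * n.+1 + n.+1)%N) ?exprD; last by lia.
set Q := q ^+ n.+1 in V0 stepT *; set P := q ^+ (n.+1 * n.+1) in Vn *.
transitivity ((1 + 2 * S) * M n * (1 + Q) + 2 * ((-1) ^+ n.+1 * P) * M n * (1 + Q)).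
  by ring.
rewrite IHn mulrDl -mulrA stepT V0 Vn exprS; ring.
Qed.

End FiniteProducts.

(** * Theta series *)

Section Theta.
Variable R : comNzRingType.
Implicit Types a b : series R.

(** Partial sums of Ramanujan's theta functions: q^(k^2) over all integers k, folded to k >= 1, and
    q^(k(k+1)/2) over k >= 0. *)
Definition phi_part n : series R := 1 + 2 * \sum_(0 <= s < n) sq ^+ (s.+1 * s.+1).
Definition psi_part n : series R := \sum_(0 <= s < n.+1) sq ^+ 'C(s.+1, 2).
Definition phi := series_lim phi_part.
Definition psi := series_lim psi_part.

Lemma phi_eqmod n : series_eqmod n.+1 phi (phi_part n).
Proof.
apply: series_lim_eqmod => k i lt_ik.
rewrite /phi_part big_nat_recr //= mulrDr addrA coefsD [2 * sq ^+ _]mulrC.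
by rewrite (series_eqmod_sqXM (T := k.+1)) ?addr0 //; nia.
Qed.

Lemma psi_eqmod n : series_eqmod n.+1 psi (psi_part n).
Proof.
apply: series_lim_eqmod => k i lt_ik.
rewrite /psi_part big_nat_recr //= coefsD -[sq ^+ _]mulr1.
by rewrite (series_eqmod_sqXM (T := k.+1)) ?addr0 // binS bin1 leq_addl.
Qed.

Lemma phi0 : phi 0%N = 1.
Proof. by rewrite /phi /series_lim /phi_part big_geq // mulr0 addr0. Qed.

Lemma psi0 : psi 0%N = 1.
Proof. by rewrite /psi /series_lim /psi_part big_nat1 coefs_sqX. Qed.

Lemma sneg_phi_part n :
  sneg (phi_part n)
  = 1 + 2 * \sum_(0 <= s < n) (-1) ^+ s.+1 * sq ^+ (s.+1 * s.+1).
Proof.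
rewrite /phi_part rmorphD rmorph1 rmorphM rmorph_nat rmorph_sum /=.
congr (1 + 2 * _); apply: eq_bigr => s _.
by rewrite rmorphXn /= sneg_sq [(- sq) ^+ _]exprNn -[in LHS]signr_odd oddM andbb signr_odd.
Qed.

(** * Product expansions of the theta series, where x is 1 or -1 *)

Definition full_prod (x : series R) n := \prod_(0 <= j < n) (1 + x * sq ^+ j.+1).
Definition even_prod (x : series R) n := \prod_(0 <= j < n) (1 + x * sq ^+ j.*2.+2).
Definition odd_prod (x : series R) n := \prod_(0 <= j < n) (1 + x * sq ^+ j.*2.+1).

Lemma full_prod_parity x n : full_prod x n.*2 = even_prod x n * odd_prod x n.
Proof.
rewrite /full_prod /even_prod /odd_prod.
elim: n => [|n IHn]; first by rewrite !big_geq // mulr1.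
by rewrite doubleS !big_nat_recr //= IHn; ring.
Qed.

Lemma even_prod0 x n : even_prod x n 0%N = 1.
Proof.
rewrite /even_prod coefs_prod0 big1 // => j _.
by rewrite coefsD coefsM0 coefs_sqX mulr0 addr0.
Qed.

Lemma odd_prod0 x n : odd_prod x n 0%N = 1.
Proof.
rewrite /odd_prod coefs_prod0 big1 // => j _.
by rewrite coefsD coefsM0 coefs_sqX mulr0 addr0.
Qed.

(** All correction terms in [shanks_theta] are divisible by q^(n+1). *)
Lemma sneg_phi_gauss n :
  series_eqmod n.+1 (sneg phi * full_prod 1 n) (full_prod (- 1) n).
Proof.
have ->: full_prod 1 n = \prod_(0 <= j < n) (1 + sq ^+ j.+1).
  by apply: eq_bigr => j _; rewrite mul1r.
have ->: full_prod (- 1) n = \prod_(0 <= j < n) (1 - sq ^+ j.+1).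
  by apply: eq_bigr => j _; rewrite mulN1r.
apply: (series_eqmod_trans
  (series_eqmodMr _ (series_eqmod_sneg (phi_eqmod (n := n))))).
rewrite sneg_phi_part shanks_theta => i lt_in; rewrite coefsD mulr_sumr coefs_sum.
rewrite [X in _ + X]big1 ?addr0 // => s _.
rewrite [X in X i](_ : _ = sq ^+ (s.+1 * n.+1) * (2 * (-1) ^+ s.+1
  * (\prod_(0 <= j < s) (1 + sq ^+ j.+1)
     * \prod_(s.+1 <= j < n) (1 - sq ^+ j.+1)))); last by ring.
by rewrite (series_eqmod_sqXM (T := n.+1)) // leq_pmull.
Qed.

(* phi(q) = phi(q^4) + 2 q psi(q^8) *)
Lemma phi_dissection : phi = sdil (sdil phi) + 2 * sq * sdil (sdil (sdil psi)).
Proof.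
(* Even roots (2k+2)^2 = 4(k+1)^2 give phi(q^4); odd roots (2k+1)^2 = 8 C(k+1,2) + 1 give 2 q
   psi(q^8). Each kind occurs n + 1 times. *)
have part n : phi_part n.+1.*2
    = sdil (sdil (phi_part n.+1)) + 2 * sq * sdil (sdil (sdil (psi_part n))).
  rewrite /phi_part /psi_part !(rmorphD, rmorph1, rmorphM, rmorph_nat) /=.
  rewrite -addrA -mulrA -mulrDr; congr (1 + 2 * _).
  rewrite !rmorph_sum /= mulr_sumr -big_split /=.
  elim: (n.+1) => [|k IHk]; first by rewrite !big_geq.
  rewrite doubleS !big_nat_recr //= IHk -!addrA; congr (_ + _).
  have sqr_odd : (k.*2.+1 * k.*2.+1 = ('C(k.+1, 2)).*2.*2.*2.+1)%N.
    elim: (k) => [|d IHd] //; rewrite doubleS binS bin1; move: IHd; lia.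
  rewrite !sdil_sqX sqr_odd exprS addrC; congr (sq ^+ _ + _); lia.
apply: series_eqmod_all => T.
have le_T : (T.+1 <= (T.+1).*2.+1)%N by lia.
apply: (series_eqmod_trans (series_eqmod_leq le_T (phi_eqmod (n := _)))).
rewrite part; apply: series_eqmod_sym.
apply: series_eqmodD; last apply: series_eqmodMl.
  apply: (@series_eqmod_leq _ _ (T.+2).*2.*2); first by lia.
  by do 2!apply: series_eqmod_sdil; apply: phi_eqmod.
apply: (@series_eqmod_leq _ _ (T.+1).*2.*2.*2); first by lia.
by do 3!apply: series_eqmod_sdil; apply: psi_eqmod.
Qed.

Lemma sneg_phi_prod m :
  series_eqmod m.+1 (sneg phi * (even_prod 1 m * odd_prod 1 m))
                    (even_prod (- 1) m * odd_prod (- 1) m).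
Proof.
rewrite -!full_prod_parity.
by apply: (series_eqmod_leq _ (sneg_phi_gauss (n := _))); lia.
Qed.

(** The substitution q -> -q in [sneg_phi_prod] fixes the even products and exchanges the two odd
    ones. *)
Lemma phi_prod m :
  series_eqmod m.+1 (phi * (even_prod 1 m * odd_prod (- 1) m))
                    (even_prod (- 1) m * odd_prod 1 m).
Proof.
have sneg_even (x : series R) : sneg x = x -> sneg (even_prod x m) = even_prod x m.
  move=> sx; rewrite /even_prod rmorph_prod; apply: eq_bigr => j _.
  rewrite rmorphD rmorph1 rmorphM rmorphXn /= sx sneg_sq.
  by rewrite [(- sq) ^+ _]exprNn -signr_odd /= odd_double mul1r.
have sneg_odd (x : series R) : sneg x = x -> sneg (odd_prod x m) = odd_prod (- x) m.
  move=> sx; rewrite /odd_prod rmorph_prod; apply: eq_bigr => j _.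
  rewrite rmorphD rmorph1 rmorphM rmorphXn /= sx sneg_sq.
  by rewrite [(- sq) ^+ _]exprNn -signr_odd /= odd_double mulN1r mulrN mulNr.
have := series_eqmod_sneg (sneg_phi_prod (m := m)).
rewrite !rmorphM /= snegK !sneg_even ?sneg_odd ?opprK //;
  by rewrite ?rmorphN rmorph1.
Qed.

Lemma sdil_sneg_phi_prod m :
  series_eqmod m.+1 (sdil (sneg phi) * even_prod 1 m) (even_prod (- 1) m).
Proof.
have sdil_even (x : series R) : sdil x = x ->
    sdil (full_prod x m) = even_prod x m.
  move=> sx; rewrite /full_prod rmorph_prod; apply: eq_bigr => j _.
  by rewrite rmorphD rmorph1 rmorphM /= sdil_sqX sx.
have := series_eqmod_sdil (sneg_phi_gauss (n := m)).
rewrite rmorphM /=.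
rewrite !sdil_even ?rmorphN ?rmorph1 //; apply: series_eqmod_leq; lia.
Qed.

Lemma phi_sneg_phi : phi * sneg phi = sdil (sneg phi) ^+ 2.
Proof.
apply: series_eqmod_all => m.
pose D := even_prod 1 m; pose E := even_prod (- 1) m.
pose A := odd_prod 1 m; pose B := odd_prod (- 1) m.
(* Modulo q^(m+1), phi(q) is EA/(DB), phi(-q) is EB/(DA) and phi(-q^2) is E/D, so multiplication by
   D^2 A B turns both sides into E^2 A B. *)
have K0 : (D * D * A * B) 0%N = 1.
  by rewrite !coefsM0 /D /A /B !even_prod0 !odd_prod0 !mulr1.
apply: (series_eqmod_cancel K0).
rewrite (_ : _ * _ = (phi * (D * B)) * (sneg phi * (D * A))); last by ring.
rewrite (_ : _ ^+ 2 * _ = (sdil (sneg phi) * D) ^+ 2 * (A * B)); last by ring.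
apply: (series_eqmod_trans (series_eqmodM (phi_prod (m := m)) (sneg_phi_prod (m := m)))).
rewrite -/D -/E -/A -/B (_ : _ * _ = E * E * (A * B)); last by ring.
apply: series_eqmodMr; rewrite expr2.
by apply: series_eqmodM; apply: series_eqmod_sym; apply: sdil_sneg_phi_prod.
Qed.

End Theta.

Arguments phi {R}.
Arguments psi {R}.

(** * Theta identities and the quotient phi(-q)/phi(q) in characteristic 3 *)

(* The theta series are kept abstract here: [rmorphD] would unfold them. *)
Section CharThree.
Variables (R : comNzRingType) (phi psi : series R).
Hypothesis R3 : 3%:R = 0 :> R.
Hypotheses (phi0 : phi 0%N = 1) (psi0 : psi 0%N = 1).
Hypothesis phi_sneg_phi : phi * sneg phi = sdil (sneg phi) ^+ 2.
Hypothesis phi_dissection :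
  phi = sdil (sdil phi) + 2 * sq * sdil (sdil (sdil psi)).
Implicit Types a b : series R.

Lemma series3 a : a *+ 3 = 0.
Proof. by apply/funext => n; rewrite coefsMn -mulr_natr R3 mulr0. Qed.

(** Doubling is its own inverse, since 4 = 1. *)
Lemma series_double_inj a b : a *+ 2 = b *+ 2 -> a = b.
Proof.
move=> /(congr1 (fun c => c *+ 2)); rewrite -!mulrnA /= => eq_ab.
by rewrite -[a]addr0 -(series3 a) -mulrS eq_ab mulrS series3 addr0.
Qed.

Lemma sder_cube a : sder (a ^+ 3) = 0.
Proof.
rewrite !exprS expr0 mulr1 !sderM -[RHS](series3 (a * a * sder a)); ring.
Qed.

Lemma sder0_coef a n : sder a = 0 -> ~~ (3 %| n)%N -> a n = 0.
Proof.
move=> da n3; have an : a n *+ n = 0 by rewrite -[LHS]/(sder a n) da.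
move: an; set x := a n => xn.
have x3 k : x *+ (k * 3)%N = 0 by rewrite mulrnA -mulr_natr R3 mulr0.
have n_mod : (n %% 3 = 1 \/ n %% 3 = 2)%N by move: n3; lia.
have x_mod : x *+ (n %% 3)%N = 0.
  by move: xn; rewrite [in X in X -> _](divn_eq n 3) mulrnDr x3 add0r.
case: n_mod x_mod => -> // x2.
by rewrite -[x]addr0 -[X in _ + X]x2 -mulrS (x3 1%N).
Qed.

(* Z(q) = f_1^3 in the notation of eta quotients; here this is only seen
   through the functional equation Z(q)^2 = phi(-q)^3 Z(q^2). *)
Definition cube_series : series R := sneg phi ^+ 2 * psi.

(** After q -> q^2 the left side is phi(q) phi(-q), which the dissection turns into (phi(q^4) + 2 q
    psi(q^8)) (phi(q^4) - 2 q psi(q^8)). *)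
Lemma sneg_phi_sqr : sneg phi ^+ 2
  = sdil phi ^+ 2 - 4 * sq * sdil (sdil psi) ^+ 2 :> series R.
Proof.
apply: sdil_inj; rewrite rmorphXn /= -phi_sneg_phi [phi in LHS]phi_dissection.
rewrite !(rmorphB, rmorphD, rmorphM, rmorphXn, rmorph_nat) /= !sneg_sdil sneg_sq sdil_sq.
ring.
Qed.

Lemma phi_sqr :
  phi ^+ 2 = sdil phi ^+ 2 + 4 * sq * sdil (sdil psi) ^+ 2 :> series R.
Proof.
have := congr1 (@sneg R) sneg_phi_sqr.
rewrite !(rmorphB, rmorphD, rmorphM, rmorphXn, rmorph_nat) /= snegK !sneg_sdil sneg_sq.
by rewrite expr2 => ->; ring.
Qed.

(** The difference phi(q)^2 - phi(-q)^2 is 8 q psi(q^4)^2 by the formulas for the squares and 8 q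
    phi(q^4) psi(q^8) by the dissection. Cancelling 8 q and undoing q -> q^4 gives the claim. *)
Lemma psi_sqr : psi ^+ 2 = phi * sdil psi :> series R.
Proof.
pose P := sdil (sdil phi); pose T := sdil (sdil (sdil psi)); pose S := sdil (sdil psi).
have phiE : phi = P + 2 * sq * T := phi_dissection.
have sphiE : sneg phi = P - 2 * sq * T.
  rewrite phi_dissection !(rmorphD, rmorphM, rmorph_nat) /= !sneg_sdil sneg_sq.
  by rewrite mulrN mulNr.
have sqE : (sq * S ^+ 2) *+ 8 = (sq * (P * T)) *+ 8.
  transitivity (phi ^+ 2 - sneg phi ^+ 2); first by rewrite phi_sqr sneg_phi_sqr; ring.
  by rewrite sphiE {1}phiE; ring.
apply: sdil_inj; apply: sdil_inj; apply: sq_lreg.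
do 3!apply: series_double_inj; rewrite -!mulrnA.
by rewrite !rmorphXn !rmorphM.
Qed.

Lemma cube_series_sqr : cube_series ^+ 2 = sneg phi ^+ 3 * sdil cube_series.
Proof.
rewrite /cube_series rmorphM rmorphXn /= -phi_sneg_phi exprMn psi_sqr; ring.
Qed.

Lemma cube_series0 : cube_series 0%N = 1.
Proof.
by rewrite /cube_series coefsM0 coefsX0 /sneg mul1r phi0 psi0 expr1n mulr1.
Qed.

Lemma sder_cube_series : sder cube_series = 0.
Proof.
set Z := cube_series; set U := sder Z.
(* In the derivative of the functional equation the cube acts as a constant, and both sides carry a
   factor 2, from Z^2 and from q -> q^2. *)
have ZU : U * Z = sneg phi ^+ 3 * sdil U.
  apply: series_double_inj; have := congr1 (@sder R) cube_series_sqr.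
  rewrite -/Z expr2 sderM [sder (sneg phi ^+ 3 * _)]sderM sder_cube mul0r add0r.
  by rewrite sder_sdil -/U mulrnAr => <-; rewrite mulr2n [Z * U]mulrC.
apply: series_eqmod_all => T.
suff: forall i, U i = 0 by move=> U0 i _; rewrite U0.
elim/ltn_ind => i IHi; case: i => [|i] in IHi *; first exact: mulr0n.
(* Up to degree i + 1, [sdil U] only involves [U] at indices at most (i + 1)/2, where it vanishes by
   induction. *)
apply: (@series_eqmod_cancel _ i.+2 Z U 0 cube_series0) => // j lt_j.
rewrite ZU mul0r coefsM big1 // => k _; rewrite /sdil; case: ifP; rewrite ?mulr0 //.
by move=> _; rewrite IHi ?mulr0 //; move: (ltn_ord k) lt_j; lia.
Qed.

Lemma theta_quotient_coef a n :
  a * phi = sneg phi -> ~~ (3 %| n)%N -> a (4 * n + 2)%N = 0.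
Proof.
move=> a_phi n3.
(* Two bisections: [K n] is [a (4 * n + 2)]. *)
pose H : series R := fun n => a n.*2; pose K : series R := fun n => H n.*2.+1.
have H_phi : H * sneg phi ^+ 2 = phi ^+ 2.
  apply: sdil_inj; apply: series_double_inj.
  have sa_phi : sneg a * sneg phi = phi.
    by have := congr1 (@sneg R) a_phi; rewrite snegK rmorphM.
  (* Twice the left side is (a(q) + a(-q)) phi(q) phi(-q) = phi(-q)^2 + phi(q)^2 = 2 phi(q^2)^2. *)
  transitivity ((a + sneg a) * (phi * sneg phi)).
    by rewrite series_even_part phi_sneg_phi rmorphM rmorphXn /= mulrnAl.
  transitivity (sneg phi ^+ 2 + phi ^+ 2); last first.
    by rewrite rmorphXn /= sneg_phi_sqr [phi ^+ 2]phi_sqr; ring.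
  rewrite mulrDl mulrA a_phi [phi * _]mulrC mulrA sa_phi; ring.
have K_phi : K * sneg phi ^+ 6 = (sdil cube_series ^+ 2) *+ 8.
  have sH_phi : sneg H * phi ^+ 2 = sneg phi ^+ 2.
    by have := congr1 (@sneg R) H_phi; rewrite rmorphM !rmorphXn /= snegK.
  have K4 : K * sneg phi ^+ 4 = (phi ^+ 2 * sdil psi ^+ 2) *+ 8.
    apply: sdil_inj; apply: sq_lreg; apply: series_double_inj.
    (* Here 2 q K(q^2) phi(-q^2)^4 = phi(q)^4 - phi(-q)^4, which factors as 8 q psi(q^4)^2 times 2
       phi(q^2)^2. *)
    transitivity ((H - sneg H) * (phi * sneg phi) ^+ 2).
      by rewrite series_odd_part phi_sneg_phi -exprM rmorphM rmorphXn /= mulrnAl mulrA.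
    transitivity ((phi ^+ 2) ^+ 2 - (sneg phi ^+ 2) ^+ 2).
      rewrite (_ : _ * _ = phi ^+ 2 * (H * sneg phi ^+ 2)
                           - sneg phi ^+ 2 * (sneg H * phi ^+ 2)); last by ring.
      by rewrite H_phi sH_phi -!expr2.
    rewrite rmorphMn rmorphM !rmorphXn /= sneg_phi_sqr [phi ^+ 2]phi_sqr; ring.
  (* The extra factor phi(-q)^2 completes the square of phi(q) phi(-q) psi(q^2) = Z(q^2). *)
  have -> : sneg phi ^+ 6 = sneg phi ^+ 4 * sneg phi ^+ 2 by rewrite -exprD.
  rewrite mulrA K4 /cube_series rmorphM rmorphXn /= -phi_sneg_phi; ring.
(* The sixth power is a cube and Z(q^2) has derivative 0, so differentiating [K_phi] leaves K'
   phi(-q)^6 = 0. *)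
have dK : sder K = 0.
  apply: (series_cancel (a := sneg phi ^+ 6)).
    by rewrite coefsX0 /sneg mul1r phi0 expr1n.
  have := congr1 (@sder R) K_phi; rewrite sderMn expr2 [sder (sdil _ * _)]sderM.
  rewrite sder_sdil sder_cube_series rmorph0 mul0rn mulr0 mul0r addr0 mul0rn.
  have -> : sneg phi ^+ 6 = (sneg phi ^+ 2) ^+ 3 by rewrite -exprM.
  by rewrite sderM sder_cube mulr0 addr0 mul0r.
have -> : (4 * n + 2 = n.*2.+1.*2)%N by lia.
exact: (sder0_coef dK n3).
Qed.

End CharThree.

(** * The generating function *)

Section SeriesMap.
Variables (A B : comNzRingType) (f : {rmorphism A -> B}).

Definition smap (a : series A) : series B := fun n => f (a n).

Fact smap_is_zmod_morphism : zmod_morphism smap.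
Proof. by move=> a b; apply/funext => n; rewrite coefsB /smap -rmorphB. Qed.

Fact smap_is_monoid_morphism : monoid_morphism smap.
Proof.
split=> [|a b]; apply/funext => n; first by rewrite /smap !coefs1 rmorph_nat.
by rewrite /smap !coefsM rmorph_sum; apply: eq_bigr => i _; rewrite rmorphM.
Qed.

HB.instance Definition _ :=
  GRing.isZmodMorphism.Build (series A) (series B) smap smap_is_zmod_morphism.
HB.instance Definition _ :=
  GRing.isMonoidMorphism.Build (series A) (series B) smap smap_is_monoid_morphism.

Lemma smap_sq : smap sq = sq.
Proof. by apply/funext => n; rewrite /smap /sq rmorph_nat. Qed.

End SeriesMap.

Lemma fps_qE m : fps_q m = sq ^+ m :> series int.
Proof. by apply/funext => n; rewrite coefs_sqX. Qed.

(** The division is replaced by an inverse v known through its equation, which ring morphisms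
    preserve. *)
Lemma schur3_factorE j (x := sq ^+ j.*2.+1 : series int) :
  exists2 v : series int, schur3_factor j.+1 = (1 + x) * (1 - x ^+ 3) * v :> series int
    & (1 + x ^+ 3) * (1 - x) * v = 1.
Proof.
have r_eq : (2 * j.+1 - 1 = j.*2.+1)%N by lia.
have x3 : x ^+ 3 = fps_q (3 * (2 * j.+1 - 1))%N by rewrite fps_qE -exprM r_eq mulnC.
have x1 : x = fps_q (2 * j.+1 - 1)%N by rewrite fps_qE r_eq.
exists (fps_inv ((1 + x ^+ 3) * (1 - x) : series int)); first by rewrite x3 x1.
apply/funext => n; apply: fps_mulV.
by rewrite coefsM0 coefsB coefsD /x -exprM !coefs_sqX coefs1.
Qed.

Lemma S3bar_eqmod n :
  series_eqmod n.+1 (S3bar : series int)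
    (\prod_(0 <= j < n) (schur3_factor j.+1 : series int)).
Proof.
have -> : \prod_(0 <= j < n) (schur3_factor j.+1 : series int)
    = fps_partial_prod schur3_factor n.
  by elim: n => [|n IHn]; [rewrite big_geq | rewrite big_nat_recr //= IHn].
by move=> i; rewrite ltnS => le_in; rewrite S3bar_limit.
Qed.

(** * Reduction modulo 3 *)

Lemma S3bar_mod3_phi (R : comNzRingType) : 3%:R = 0 :> R ->
  smap (intr : int -> R) (S3bar : series int) * phi = sneg phi.
Proof.
move=> R3; set G := smap _ _; apply: series_eqmod_all => m.
pose D : series R := even_prod 1 m; pose E : series R := even_prod (- 1) m.
pose A : series R := odd_prod 1 m; pose B : series R := odd_prod (- 1) m.
have GA : series_eqmod m.+1 (G * A ^+ 2) (B ^+ 2).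
  (* Since 1 + x^3 = (1 + x)^3 and 1 - x^3 = (1 - x)^3, each factor is (1 - x)^2 / (1 + x)^2. *)
  have step j : smap (intr : int -> R) (schur3_factor j.+1) * (1 + 1 * sq ^+ j.*2.+1) ^+ 2
      = (1 + - 1 * sq ^+ j.*2.+1) ^+ 2.
    have [v -> /(congr1 (smap (intr : int -> R)))] := schur3_factorE j.
    rewrite !(rmorphM, rmorphD, rmorphN, rmorph1, rmorphXn) /= smap_sq.
    set x := sq ^+ _; set w := smap _ _ => vx.
    have c3 : (1 + x) ^+ 3 = 1 + x ^+ 3.
      by rewrite -[RHS]addr0 -(series3 R3 (x + x ^+ 2)); ring.
    have d3 : (1 - x) ^+ 3 = 1 - x ^+ 3.
      by rewrite -[RHS]addr0 -(series3 R3 (x ^+ 2 - x)); ring.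
    transitivity ((1 + x) ^+ 3 * (1 - x ^+ 3) * w); first by ring.
    transitivity ((1 - x) ^+ 2 * ((1 + x ^+ 3) * (1 - x) * w)).
      by rewrite c3 -d3; ring.
    by rewrite vx mulr1 mulN1r.
  have -> : B ^+ 2 = smap (intr : int -> R)
      (\prod_(0 <= j < m) (schur3_factor j.+1 : series int)) * A ^+ 2.
    rewrite /A /B /odd_prod -!prodrXl rmorph_prod -big_split /=.
    by apply: eq_bigr => j _; rewrite step.
  by apply: series_eqmodMr => i lt_im; rewrite /G /smap (S3bar_eqmod lt_im).
(* B^2/A^2 is the quotient of EB/(DA) by EA/(DB); multiplication by A^2 D B clears the
   denominators. *)
have K0 : (A ^+ 2 * (D * B)) 0%N = 1.
  by rewrite !coefsM0 coefsX0 /D /A /B even_prod0 !odd_prod0 expr1n !mulr1.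
apply: (series_eqmod_cancel K0).
rewrite (_ : _ * _ = G * A ^+ 2 * (phi * (D * B))); last by ring.
apply: (series_eqmod_trans (series_eqmodM GA (@phi_prod R m))).
rewrite -/E -/A (_ : _ * _ = E * B * (A * B)); last by ring.
rewrite (_ : sneg phi * _ = sneg phi * (D * A) * (A * B)); last by ring.
by apply/series_eqmodMr/series_eqmod_sym/(@sneg_phi_prod R m).
Qed.

Lemma S3bar_mod3 n : ~~ (3 %| n)%N -> (3 %| S3bar (4 * n + 2)%N)%Z.
Proof.
move=> n3; have F3 : 3%:R = 0 :> 'F_3 by apply/eqP.
have := @theta_quotient_coef 'F_3 phi psi F3 (phi0 _) (psi0 _) (phi_sneg_phi _)
  (phi_dissection _) _ n (S3bar_mod3_phi F3) n3.
by move/eqP; rewrite /smap -(dvdz_pcharf (pchar_Fp (isT : prime 3))).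
Qed.

(** * Reduction modulo 4 and divisor counts *)

Lemma S3bar_mod4 n : (0 < n)%N ->
  exists c : int, S3bar n = 4 * c + 2 * \sum_(0 <= j < n)
    ((j.*2.+1 %| n)%N + (3 * j.*2.+1 %| n)%N)%:R.
Proof.
move=> n_gt0.
(* The expansion of q^r / (1 - q^r), for r > 0. *)
pose g r : series int := fun k => ((0 < k) && (r %| k))%N%:R.
have gE r : (0 < r)%N -> g r * (1 - sq ^+ r) = sq ^+ r.
  move=> r_gt0; apply/funext => k.
  rewrite mulrBr mulr1 coefsB [g r * _]mulrC coefs_sqXM coefs_sqX /g.
  case: (leqP r k) => [/subnKC <- | lt_kr].
    rewrite addKn dvdn_addr // addn_gt0 r_gt0 /= -[X in _ == X]addn0 eqn_add2l.
    by case: (k - r)%N => [|d] /=; rewrite ?dvdn0 ?subr0 ?subrr.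
  by rewrite subr0 (ltn_eqF lt_kr); case: k lt_kr => [|k] lt_kr //; rewrite gtnNdvd.
have factor j : exists h : series int, schur3_factor j.+1
    = 1 + 2 * (g j.*2.+1 + g (3 * j.*2.+1)%N) + 4 * h :> series int.
  have [v -> vE] := schur3_factorE j; rewrite -exprM mulnC in vE *.
  have := gE (j.*2.+1) isT; have := gE (3 * j.*2.+1)%N isT.
  set x := sq ^+ j.*2.+1 in vE *; set y := sq ^+ _ in vE *.
  set a := g _ => aE; set b := g _ => bE.
  (* This is 1/(1 + y), as v inverts (1 + y)(1 - x). *)
  pose k := v * (1 - x).
  have ke : k * (1 + y) = 1 by rewrite /k -[RHS]vE; ring.
  have x1 : 1 + x = (1 - x) * (1 + 2 * b).
    by transitivity (1 - x + 2 * (b * (1 - x))); [rewrite bE | ]; ring.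
  (* The left side is the inverse of 1 + 2a = (1 + y)/(1 - y), and 1 + 2a is its own inverse modulo
     4. *)
  have y1 : (1 - y) * k = 1 + 2 * a - 4 * (a * k).
    transitivity ((1 + 2 * a) * (k * (1 + y)) - 4 * (a * k)); last by rewrite ke; ring.
    transitivity (k * (1 + y - 2 * (a * (1 - y)))); last by ring.
    by rewrite aE; ring.
  exists (a * b - (1 + 2 * b) * (a * k)).
  transitivity ((1 + 2 * b) * ((1 - y) * k)); first by rewrite x1 /k; ring.
  by rewrite y1; ring.
(* Cross terms are multiples of 4, so modulo 4 the product becomes a sum. *)
have [h hE] : exists h : series int, \prod_(0 <= j < n) (schur3_factor j.+1 : series int)
    = 1 + 2 * (\sum_(0 <= j < n) (g j.*2.+1 + g (3 * j.*2.+1)%N)) + 4 * h.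
  elim: (n) => [|m [h IHm]]; first by exists 0; rewrite !big_geq //; ring.
  have [c cE] := factor m; rewrite !big_nat_recr //= IHm cE.
  set u := \sum_(0 <= j < m) _; set w := g _ + g _.
  exists (h + c + u * w + 2 * (u * c + h * w) + 4 * (h * c)); ring.
exists (h n); rewrite (S3bar_eqmod (ltnSn n)) hE !coefsD.
rewrite [RHS]addrC; congr (_ + _); last first.
  by rewrite !mulr_natl coefsMn.
rewrite coefs1 gtn_eqF // add0r !mulr_natl coefsMn coefs_sum; congr (_ *+ _).
by apply: eq_bigr => j _; rewrite coefsD /g n_gt0 natrD.
Qed.

Lemma size_divisors_odd_logn p K :
  (0 < K)%N -> odd (logn p K) -> ~~ odd (size (divisors K)).
Proof.
move=> K_gt0 odd_K; pose P d := odd (logn p d).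
have quo d : (d \in divisors K) -> (K %/ d \in divisors K)%N.
  by rewrite -!dvdn_divisors //; apply: dvdn_div.
have quoK : {in divisors K, involutive (divn K)}.
  move=> d; rewrite -dvdn_divisors // => /dvdnP[e K_eq].
  have [d_gt0 e_gt0] : (0 < d)%N /\ (0 < e)%N.
    by move: K_gt0; rewrite K_eq muln_gt0 => /andP[].
  by rewrite {2}K_eq mulnK // K_eq mulKn.
have perm_quo : perm_eq (map (divn K) (divisors K)) (divisors K).
  apply: uniq_perm; rewrite ?divisors_uniq //.
    rewrite map_inj_in_uniq ?divisors_uniq // => d e d_in e_in eq_de.
    by rewrite -(quoK d d_in) eq_de quoK.
  move=> d; apply/mapP/idP => [[e /quo ? ->] // | d_in].
  by exists (K %/ d)%N; rewrite ?quo ?quoK.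
have countE : count (predC P) (divisors K) = count P (divisors K).
  rewrite -(permP perm_quo) count_map; apply: eq_in_count => d /=.
  rewrite -dvdn_divisors // /P => d_dvd; rewrite logn_div // oddB ?dvdn_leq_log //.
  by rewrite odd_K addTb negbK.
by rewrite -(count_predC P) countE addnn odd_double.
Qed.

(** Every divisor d of an odd K is odd, so d = 2j + 1 with j = d/2 < n. *)
Lemma sum_odd_dvdn K n : odd K -> (K <= n)%N ->
  (\sum_(0 <= j < n) (j.*2.+1 %| K) = size (divisors K))%N.
Proof.
move=> odd_K le_Kn; have K_gt0 : (0 < K)%N by case: (K) odd_K.
pose s := [seq j.*2.+1 | j <- index_iota 0 n & (j.*2.+1 %| K)%N].
transitivity (size s).
  rewrite size_map size_filter -sum1_count [RHS]big_mkcond /=.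
  by apply: eq_bigr => j _; case: ifP.
apply/perm_size/uniq_perm; rewrite ?divisors_uniq //.
  by rewrite map_inj_uniq ?filter_uniq ?iota_uniq // => i j []/double_inj.
move=> d; rewrite -dvdn_divisors //; apply/mapP/idP => [[j] | d_dvd].
  by rewrite mem_filter => /andP[? _] ->.
have odd_d : odd d by apply: dvdn_odd d_dvd odd_K.
exists d./2; last by rewrite -[LHS]odd_double_half odd_d.
rewrite mem_filter mem_index_iota /= -[(d./2).*2.+1]/(true + (d./2).*2)%N -odd_d.
rewrite odd_double_half d_dvd /= ltn_half_double (leq_ltn_trans (dvdn_leq K_gt0 d_dvd)) //.
by move: K_gt0 le_Kn; lia.
Qed.

Lemma S3bar_mod4_nonsquare p M :
  prime p -> (3 < p)%N -> odd M -> odd (logn p M) -> (4 %| S3bar (6 * M)%N)%Z.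
Proof.
move=> p_pr p_gt3 odd_M odd_v; have M_gt0 : (0 < M)%N by case: (M) odd_M.
have odd_3M : odd (3 * M) by rewrite oddM odd_M.
have odd_v3 : odd (logn p (3 * M)).
  by rewrite lognM // logn_prime // gtn_eqF.
have [|c ->] := @S3bar_mod4 (6 * M)%N; first by rewrite muln_gt0.
have -> : (\sum_(0 <= j < 6 * M) ((j.*2.+1 %| 6 * M) + (3 * j.*2.+1 %| 6 * M))%N%:R : int)
    = (size (divisors (3 * M)) + size (divisors M))%N%:R.
  rewrite -natr_sum -(@sum_odd_dvdn (3 * M) (6 * M)) //; last by lia.
  rewrite -(@sum_odd_dvdn M (6 * M)) //; last by lia.
  rewrite -big_split /=; congr (_%:R); apply: eq_bigr => j _.
  (* The odd number 2j + 1 divides 6M iff it divides 3M, and 3(2j + 1) divides 6M iff 2j + 1 divides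
     M. *)
  have co2 : coprime j.*2.+1 2 by rewrite coprimen2 /= odd_double.
  have -> : (6 * M = 2 * (3 * M))%N by lia.
  by rewrite (Gauss_dvdr _ co2) mulnCA dvdn_pmul2l // (Gauss_dvdr _ co2).
have M3_gt0 : (0 < 3 * M)%N by rewrite muln_gt0.
have even_size : ~~ odd (size (divisors (3 * M)) + size (divisors M)).
  rewrite oddD (negbTE (size_divisors_odd_logn M_gt0 odd_v)).
  by rewrite (negbTE (size_divisors_odd_logn M3_gt0 odd_v3)).
rewrite -[(_ + _)%N]odd_double_half (negbTE even_size) add0n -mul2n natrM mulrA.
by rewrite -mulrDr dvdz_mulr.
Qed.

(** * Combination of both moduli *)

Lemma S3bar_mod12_nonsquare p M :
  prime p -> (3 < p)%N -> odd M -> odd (logn p M) -> (12 %| S3bar (6 * M)%N)%Z.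
Proof.
move=> p_pr p_gt3 odd_M odd_v.
have -> : (12 : int) = 3 * 4 by [].
rewrite Gauss_dvdz // (S3bar_mod4_nonsquare p_pr) // andbT.
have -> : (6 * M = 4 * (3 * M./2 + 1) + 2)%N.
  by rewrite -{1}[M]odd_double_half odd_M; lia.
by apply: S3bar_mod3; lia.
Qed.

Theorem theorem4p9 (p : nat) (hp : prime p) (hp5 : (5 <= p)%N)
  (hleg : legendre (-1)%R p = (-1)%R) (alpha n i : nat)
  (hi1 : (1 <= i)%N) (hip : (i <= p - 1)%N) :
  (S3bar (48 * p ^ (2 * alpha + 2) * n
          + 6 * (8 * i + p) * p ^ (2 * alpha + 1))%N = 0 %[mod 12])%Z.
Proof.
pose M := (p ^ (2 * alpha + 1) * (8 * (p * n + i) + p))%N.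
have -> : (48 * p ^ (2 * alpha + 2) * n + 6 * (8 * i + p) * p ^ (2 * alpha + 1)
           = 6 * M)%N.
  rewrite (_ : 2 * alpha + 2 = (2 * alpha + 1).+1)%N ?expnS; last by lia.
  by rewrite /M; move: (p ^ _)%N => P; lia.
have odd_p : odd p by case: (even_prime hp) hp5 => [->|].
(* This cofactor is 8i modulo p, where p is odd and 0 < i < p; hence the valuation of [M] is exactly
   2 alpha + 1. *)
have p_ndvd : ~~ (p %| 8 * (p * n + i) + p)%N.
  have i_lt : (i < p)%N by lia.
  rewrite dvdn_addl // Gauss_dvdr; last by rewrite (@coprimeXr 3 p 2) // coprimen2.
  by rewrite dvdn_addr ?dvdn_mulr // gtnNdvd.
have logn_M : logn p M = (2 * alpha + 1)%N.
  rewrite /M mulnC logn_Gauss ?pfactorK //.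
  by rewrite prime_coprime.
apply/eqP; rewrite eqz_mod_dvd subr0.
apply: (S3bar_mod12_nonsquare hp); first exact: ltnW.
  by rewrite /M oddM oddX oddD odd_p orbT oddM.
by rewrite logn_M oddD oddM.
Qed.
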